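(* A decomposable curve may be Gorenstein only if it is a node. That is, let $X$ be a (germ of a) curve, possibly non-reduced, obtained by gluing two curves $X_1$ and $X_2$ along a reduced closed point. If $X$ is Gorenstein at the gluing point, then $X$ has an ordinary node there.
   Context: Curves are over $\mathbb C$ and Cohen–Macaulay (no embedded points), possibly non-reduced. A curve is Gorenstein if its dualising sheaf is a line bundle. A curve is *decomposable* if it is obtained by gluing two curves along a (reduced closed) point; in terms of local rings, $\mathcal O_X=\mathcal O_{X_1}\times_{\mathbb C}\mathcal O_{X_2}$, the fibre product over the residue field $\mathbb C$. A node is a point with complete local ring $\mathbb C[\![x,y]\!]/(xy)$. *)

(* Defs.v *)
From HB Require Import structures.
From mathcomp Require Export all_boot all_order all_algebra.
From mathcomp Require Export boolp classical_sets reals complex.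

Set Implicit Arguments.
Unset Strict Implicit.
Unset Printing Implicit Defensive.

Import GRing.Theory.
Local Open Scope classical_set_scope.
Local Open Scope ring_scope.

(* Ideals are classical sets rather than decidable predicates.               *)
Section Ideals.
Variable A : comNzRingType.
Implicit Types I S : set A.

Definition is_ideal I : Prop :=
  [/\ I 0, (forall x y, I x -> I y -> I (x + y))
    & (forall a x, I x -> I (a * x))].

Definition ideal_gen S : set A :=
  [set x | forall I, is_ideal I -> S `<=` I -> I x].

Definition ideal_exp I (n : nat) : set A :=
  ideal_gen [set x | exists2 f : 'I_n -> A,
                       (forall i, I (f i)) & x = \prod_(i < n) f i].

Definition is_prime_ideal I : Prop :=
  [/\ is_ideal I, ~ I 1 & forall x y, I (x * y) -> I x \/ I y].

Definition noetherian : Prop :=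
  forall I, is_ideal I -> exists s : seq A, I = ideal_gen [set x | x \in s].

Definition prime_chain (n : nat) : Prop :=
  exists P : 'I_n.+1 -> set A,
    (forall i, is_prime_ideal (P i)) /\
    (forall i j : 'I_n.+1, (i < j)%N -> P i `<` P j).

Definition krull_dim (d : nat) : Prop := prime_chain d /\ ~ prime_chain d.+1.

End Ideals.

Section LocalRings.
Variable A : comUnitRingType.

Definition maxid : set A := [set x | x \isn't a GRing.unit].

Definition local_ring : Prop := is_ideal maxid.

(* The submodule (xs)M of M.                                                 *)
Definition seq_submod (M : lmodType A) (xs : seq A) : set M :=
  [set y | exists m : nat -> M, y = \sum_(i < size xs) xs`_i *: m i].

Definition regular_seq (M : lmodType A) (xs : seq A) : Prop :=
  (forall i, (i < size xs)%N -> forall y : M,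
     seq_submod (take i xs) (xs`_i *: y) -> seq_submod (take i xs) y) /\
  (exists y : M, ~ seq_submod xs y).

Definition has_regular_seq (M : lmodType A) (n : nat) : Prop :=
  exists xs : seq A,
    [/\ size xs = n, (forall x, x \in xs -> maxid x) & regular_seq M xs].

Definition depth (M : lmodType A) (n : nat) : Prop :=
  has_regular_seq M n /\ ~ has_regular_seq M n.+1.

Definition cohen_macaulay : Prop :=
  exists d, krull_dim A d /\ depth A^o d.

Definition finitely_generated (M : lmodType A) : Prop :=
  exists (n : nat) (g : 'I_n -> M),
    forall y, exists a : 'I_n -> A, y = \sum_(i < n) a i *: g i.

Definition injective_module (E : lmodType A) : Prop :=
  forall (M N : lmodType A) (f : {linear M -> N}) (g : {linear M -> E}),
    injective f -> exists h : {linear N -> E}, forall x, h (f x) = g x.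

Record inj_resolution (M : lmodType A) := InjResolution {
  ires_mod : nat -> lmodType A;
  ires_aug : {linear M -> ires_mod 0%N};
  ires_diff : forall n, {linear ires_mod n -> ires_mod n.+1};
  ires_injective : forall n, injective_module (ires_mod n);
  ires_aug_inj : injective ires_aug;
  ires_exact0 : forall x, ires_diff 0%N x = 0 <-> exists y, x = ires_aug y;
  ires_exact : forall n x,
    ires_diff n.+1 x = 0 <-> exists y, x = ires_diff n y
}.

Definition finite_injective_dim (M : lmodType A) : Prop :=
  exists (I : inj_resolution M) (N : nat),
    forall n, (N <= n)%N -> forall x : ires_mod I n, x = 0.

(* Hom_A(k, M) for k = A / maxid, via f |-> f 1.                             *)
Definition socle (M : lmodType A) : set M :=
  [set x | forall a, maxid a -> a *: x = 0].

Definition ext_cocycle (M : lmodType A) (I : inj_resolution M) (n : nat) :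
    set (ires_mod I n) :=
  [set x | socle x /\ ires_diff I n x = 0].

Definition ext_coboundary (M : lmodType A) (I : inj_resolution M) (n : nat) :
    set (ires_mod I n) :=
  match n with
  | 0 => [set 0]
  | n'.+1 => ires_diff I n' @` @socle (ires_mod I n')
  end.

(* dim_k Ext^n_A(k, M) = r, where Ext^n_A(k, M) is the n-th cohomology of
   Hom_A(k, I) and z induces a k-basis of it: A acts on it through k, so
   coefficients are taken in A and independence is modulo maxid.             *)
Definition ext_dim (M : lmodType A) (n r : nat) : Prop :=
  exists (I : inj_resolution M) (z : 'I_r -> ires_mod I n),
    [/\ forall i, ext_cocycle (z i),
        forall x, ext_cocycle x -> exists a : 'I_r -> A,
          ext_coboundary (x - \sum_(i < r) a i *: z i)
      & forall a : 'I_r -> A,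
          ext_coboundary (\sum_(i < r) a i *: z i) -> forall i, maxid (a i)].

(* Dualising (canonical) module of a Cohen-Macaulay local ring, as in Bruns
   and Herzog, Cohen-Macaulay rings, Definition 3.3.1: a maximal
   Cohen-Macaulay module of type 1 and of finite injective dimension.        *)
Definition dualising_module (W : lmodType A) : Prop :=
  finitely_generated W /\
  exists d, [/\ krull_dim A d, depth W d, ext_dim W d 1
              & finite_injective_dim W].

Definition free_rank1 (W : lmodType A) : Prop :=
  exists f : {linear A^o -> W}, bijective f.

Definition gorenstein : Prop :=
  exists W : lmodType A, dualising_module W /\ free_rank1 W.

End LocalRings.

Section PowerSeries.
Variable K : comNzRingType.

Record fps : Type := Fps { fcoef : nat -> K }.

HB.instance Definition _ := gen_eqMixin fps.
HB.instance Definition _ := gen_choiceMixin fps.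

Lemma fpsP (f g : fps) : fcoef f =1 fcoef g -> f = g.
Proof. by case: f g => [f] [g] /= /funext ->. Qed.

Definition fps_zero : fps := Fps (fun=> 0).
Definition fps_opp (f : fps) : fps := Fps (fun n => - fcoef f n).
Definition fps_add (f g : fps) : fps := Fps (fun n => fcoef f n + fcoef g n).
Definition fpsC (c : K) : fps := Fps (fun n => if n == 0%N then c else 0).
Definition fpsX : fps := Fps (fun n => (n == 1%N)%:R).
Definition fps_mul (f g : fps) : fps :=
  Fps (fun n => \sum_(i < n.+1) fcoef f i * fcoef g (n - i)%N).

Fact fps_addA : associative fps_add.
Proof. by move=> f g h; apply: fpsP => n /=; rewrite addrA. Qed.

Fact fps_addC : commutative fps_add.
Proof. by move=> f g; apply: fpsP => n /=; rewrite addrC. Qed.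

Fact fps_add0 : left_id fps_zero fps_add.
Proof. by move=> f; apply: fpsP => n /=; rewrite add0r. Qed.

Fact fps_addN : left_inverse fps_zero fps_opp fps_add.
Proof. by move=> f; apply: fpsP => n /=; rewrite addNr. Qed.

HB.instance Definition _ :=
  GRing.isZmodule.Build fps fps_addA fps_addC fps_add0 fps_addN.

Let trunc n (f : fps) : {poly K} := \poly_(i < n.+1) fcoef f i.

Let coef_trunc n f i : (i <= n)%N -> (trunc n f)`_i = fcoef f i.
Proof. by move=> le_in; rewrite coef_poly ltnS le_in. Qed.

Let coef_truncM n f g i : (i <= n)%N ->
  (trunc n f * trunc n g)`_i = fcoef (fps_mul f g) i.
Proof.
move=> le_in; rewrite coefM; apply: eq_bigr => j _.
rewrite !coef_trunc ?(leq_trans (leq_subr _ _)) //.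
by rewrite (leq_trans _ le_in) // -ltnS.
Qed.

Fact fps_mulC : commutative fps_mul.
Proof.
by move=> f g; apply: fpsP => n; rewrite -!(coef_truncM _ _ (leqnn n)) mulrC.
Qed.

Fact fps_mulA : associative fps_mul.
Proof.
move=> f g h; apply: fpsP => n.
transitivity (trunc n f * (trunc n g * trunc n h))`_n.
  rewrite coefM; apply: eq_bigr => j _.
  by rewrite (coef_trunc _ (leq_ord j)) coef_truncM ?leq_subr.
rewrite mulrA coefM; apply: eq_bigr => j _.
by rewrite (coef_truncM _ _ (leq_ord j)) coef_trunc ?leq_subr.
Qed.

Fact fps_mul1 : left_id (fpsC 1) fps_mul.
Proof.
move=> f; apply: fpsP => n; rewrite /= big_ord_recl /= subn0 mul1r.
by rewrite big1 ?addr0 // => i _; rewrite /= mul0r.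
Qed.

Fact fps_mulDl : left_distributive fps_mul fps_add.
Proof.
move=> f g h; apply: fpsP => n; rewrite /= -big_split /=.
by apply: eq_bigr => i _; rewrite mulrDl.
Qed.

Fact fps_oner_neq0 : fpsC 1 != fps_zero.
Proof.
by apply/eqP => /(congr1 (fun f : fps => fcoef f 0%N))/eqP; rewrite /= oner_eq0.
Qed.

HB.instance Definition _ := GRing.Zmodule_isComNzRing.Build fps
  fps_mulA fps_mulC fps_mul1 fps_mulDl fps_oner_neq0.

End PowerSeries.

(* K[[x, y]], with x the variable of the coefficient ring K[[x]].            *)
Definition fps2 (K : comNzRingType) : comNzRingType := fps (fps K).
Definition fps2C (K : comNzRingType) (c : K) : fps2 K := fpsC (fpsC c).
Definition fps2x (K : comNzRingType) : fps2 K := fpsC (fpsX K).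
Definition fps2y (K : comNzRingType) : fps2 K := fpsX (fps K).

Section Germs.
Variable K : fieldType.

(* c is the class of a in the residue field.                                 *)
Definition has_residue (A : comUnitAlgType K) (a : A) (c : K) : Prop :=
  maxid (a - c%:A).

(* The local ring of a Cohen-Macaulay curve at a K-rational closed point; this
   includes algebraic, analytic and formal germs.                            *)
Definition curve_germ (A : comUnitAlgType K) : Prop :=
  [/\ noetherian A, local_ring A,
      forall a : A, exists c : K, has_residue a c,
      krull_dim A 1 & cohen_macaulay A].

(* p1 and p2 identify A with the fibre product of A1 and A2 over K.          *)
Definition is_gluing (A A1 A2 : comUnitAlgType K)
    (p1 : {lrmorphism A -> A1}) (p2 : {lrmorphism A -> A2}) : Prop :=
  injective (fun a => (p1 a, p2 a)) /\
  forall a1 a2,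
    (exists c : K, has_residue a1 c /\ has_residue a2 c) <->
    (exists a, p1 a = a1 /\ p2 a = a2).

Definition decomposable (A : comUnitAlgType K) : Prop :=
  exists (A1 A2 : comUnitAlgType K)
         (p1 : {lrmorphism A -> A1}) (p2 : {lrmorphism A -> A2}),
    [/\ curve_germ A1, curve_germ A2 & is_gluing p1 p2].

(* The ideal m^n B.                                                          *)
Definition ext_maxid_exp (A : comUnitAlgType K) (B : comAlgType K)
    (iota : {lrmorphism A -> B}) (n : nat) : set B :=
  ideal_gen (iota @` ideal_exp (@maxid A) n).

(* iota exhibits B as lim_n A / m^n: it induces isomorphisms
   A / m^n -> B / m^n B, and B -> lim_n B / m^n B is bijective.  For A
   noetherian, m^n B is the kernel of the projection lim_k A / m^k -> A / m^n. *)
Definition is_completion (A : comUnitAlgType K) (B : comAlgType K)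
    (iota : {lrmorphism A -> B}) : Prop :=
  [/\ forall n a, ext_maxid_exp iota n (iota a) -> ideal_exp (@maxid A) n a,
      forall n b, exists a, ext_maxid_exp iota n (b - iota a),
      forall b, (forall n, ext_maxid_exp iota n b) -> b = 0
    & forall u : nat -> B,
        (forall n, ext_maxid_exp iota n (u n.+1 - u n)) ->
        exists b, forall n, ext_maxid_exp iota n (b - u n)].

(* phi induces an isomorphism of K-algebras K[[x, y]] / (xy) -> B.           *)
Definition is_node_presentation (B : comAlgType K)
    (phi : {rmorphism fps2 K -> B}) : Prop :=
  [/\ forall c : K, phi (fps2C c) = c%:A,
      forall b, exists s, phi s = b
    & forall s, phi s = 0 <-> exists t, s = fps2x K * fps2y K * t].

Definition node (A : comUnitAlgType K) : Prop :=
  exists (B : comAlgType K) (iota : {lrmorphism A -> B})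
         (phi : {rmorphism fps2 K -> B}),
    is_completion iota /\ is_node_presentation phi.

End Germs.

(* Main.v *)
(* Since A is Gorenstein, Ext^1(k, A) is one-dimensional, hence so is the socle
   of A/x for every regular x in the maximal ideal m.  Take x = (x1, x2) with
   x_i regular in m_i.  The socle of A/x contains the nonzero class of (x1, 0),
   hence is spanned by it.  If m1 were not principal, some u in m1 outside (x1)
   would satisfy m1 u <= x1 m1, because m1 is an associated prime of A1/x1
   (dim A1 = 1); then (u, 0) would be a second, independent socle element.  So
   m1 = (t1), and likewise m2 = (t2), with t_i regular.  Expanding in powers of
   t1 and t2 sends A to the ring of pairs of power series with equal constant
   terms, which is both the completion of A and K[[x, y]]/(xy). *)
From HB Require Import structures.
Require Import Defs.
From mathcomp Require Import ring.

Set Implicit Arguments.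
Unset Strict Implicit.
Unset Printing Implicit Defensive.

Import GRing.Theory.
Local Open Scope classical_set_scope.
Local Open Scope ring_scope.

(** * Noetherian rings *)

Section Noetherian.
Variable A : comNzRingType.
Implicit Types I J P : set A.

(** Otherwise dependent choice yields a strictly increasing sequence in [F]. Its union is an ideal
    with finitely many generators, all lying in one term, where the sequence must stop. *)
Lemma noetherian_maximal (F : set (set A)) I0 :
  noetherian A -> F I0 -> (forall I, F I -> is_ideal I) ->
  exists2 I, F I & forall J, F J -> I `<=` J -> J = I.
Proof.
move=> noethA FI0 Fideal; apply: contrapT => noMax.
have step (X : {I | F I}) : {Y : {I | F I} | sval X `<` sval Y}.
  apply: cid; case: X => I FI /=; apply: contrapT => noY; apply: noMax.
  exists I => // J FJ IJ; rewrite eqEsubset; split => //.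
  by apply: contrapT => nJI; apply: noY; exists (exist _ J FJ).
have [f [_ f_lt]] := dependent_choice step (exist _ I0 FI0).
pose G n := sval (f n).
have Gmono m n : (m <= n)%N -> G m `<=` G n.
  elim: n => [|n IHn]; first by rewrite leqn0 => /eqP ->.
  rewrite leq_eqVlt => /orP[/eqP -> //|/IHn Gmn].
  by apply: subset_trans Gmn _; case: (f_lt n).
have Gideal n : is_ideal (G n) by apply: Fideal; exact: (svalP (f n)).
pose U := [set x | exists n, G n x].
have Uideal : is_ideal U.
  split; first by exists 0%N; case: (Gideal 0%N).
  - move=> x y [m Gmx] [n Gny]; exists (maxn m n).
    have [_ addG _] := Gideal (maxn m n); apply: addG.
      exact: Gmono (leq_maxl m n) _ Gmx.
    exact: Gmono (leq_maxr m n) _ Gny.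
  - by move=> a x [n Gnx]; exists n; have [_ _ mulG] := Gideal n; exact: mulG.
have [s Us] := noethA _ Uideal.
have [N sN] : exists N, forall x, x \in s -> G N x.
  have: {subset s <= [pred x | `[< U x >]]}.
    by move=> x xs; apply/asboolP; rewrite Us => I _ /(_ x); exact.
  elim: s {Us} => [|x s IHs] sU; first by exists 0%N.
  have [N GN] : exists N, forall x, x \in s -> G N x.
    by apply: IHs => y ys; apply: sU; rewrite inE ys orbT.
  have /asboolP[n Gnx] := sU x (mem_head _ _).
  exists (maxn N n) => y; rewrite inE => /orP[/eqP ->|/GN GNy].
    exact: Gmono (leq_maxr N n) _ Gnx.
  exact: Gmono (leq_maxl N n) _ GNy.
have [_ []] := f_lt N; move=> x Gx.
have: U x by exists N.+1.
by rewrite Us; apply => //; exact: Gideal.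
Qed.

(* The prime produced is an ideal maximal among those disjoint from [S]. *)
Lemma prime_avoiding_multiplicative (S : set A) :
  noetherian A -> S 1 -> (forall x y, S x -> S y -> S (x * y)) -> ~ S 0 ->
  exists2 P, is_prime_ideal P & forall x, S x -> ~ P x.
Proof.
move=> noethA S1 Smul nS0.
pose F := [set I | is_ideal I /\ forall x, S x -> ~ I x].
have FI0 : F [set 0].
  split; last by move=> x Sx x0; apply: nS0; rewrite -x0.
  split=> //= [x y -> ->|a x ->]; first by rewrite addr0.
  by rewrite mulr0.
have Fideal I : F I -> is_ideal I by case.
have [P [[P0 addP mulP] PS] maxP] := noetherian_maximal noethA FI0 Fideal.
(* The ideal generated by [P] and [x] is strictly larger than [P], so it meets [S]. *)
have adjoin x : ~ P x -> exists s p a, [/\ S s, P p & s = p + a * x].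
  move=> nPx; apply: contrapT => nS.
  pose J := [set z | exists p a, P p /\ z = p + a * x].
  suff JP : J = P.
    by apply: nPx; rewrite -JP; exists 0, 1; rewrite add0r mul1r.
  apply: maxP; last by move=> p Pp; exists p, 0; rewrite mul0r addr0.
  split; last by move=> z Sz [p [a [Pp ze]]]; apply: nS; exists z, p, a.
  split=> [|y z [p [a [Pp ->]]] [q [b [Pq ->]]]|c z [p [a [Pp ->]]]].
  - by exists 0, 0; rewrite mul0r addr0.
  - by exists (p + q), (a + b); split; [exact: addP | ring].
  - by exists (c * p), (c * a); split; [exact: mulP | ring].
exists P => //; split=> // [|x y Pxy]; first exact: PS.
apply: contrapT => /not_orP[/adjoin[s [p [a [Ss Pp se]]]]].
move=> /adjoin[t [q [b [St Pq te]]]]; apply: (PS _ (Smul _ _ Ss St)).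
have -> : s * t = (t * p + (a * x) * q) + (a * b) * (x * y).
  by rewrite se te; ring.
by apply: (addP); [apply: (addP)|]; exact: mulP.
Qed.

(* P is a maximal colon ideal (x : u), hence prime; Q avoids the multiplicative
   set of all x^n s with s outside P, which omits 0 since x is regular. *)
Lemma prime_colon_ideal (x : A) :
  noetherian A -> GRing.lreg x -> ~ (exists b, 1 = x * b) ->
  exists u P, [/\ ~ (exists b, u = x * b),
    P = [set a | exists b, a * u = x * b], is_prime_ideal P
    & exists2 Q, is_prime_ideal Q & Q `<` P].
Proof.
move=> noethA xreg x_nunit.
pose colon u := [set a | exists b, a * u = x * b].
have colon_ideal u : is_ideal (colon u).
  split; first by exists 0; rewrite mul0r mulr0.
  - by move=> a b [c ac] [d bd]; exists (c + d); rewrite mulrDl mulrDr ac bd.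
  - by move=> a b [c bc]; exists (a * c); rewrite -mulrA bc; ring.
pose F := [set I | exists2 u, ~ (exists b, u = x * b) & I = colon u].
have FI0 : F (colon 1) by exists 1.
have Fideal I : F I -> is_ideal I by move=> [u _ ->].
have [_ [u nu ->] maxu] := noetherian_maximal noethA FI0 Fideal.
have Pprime : is_prime_ideal (colon u).
  split=> [//||a b [c abu]].
    by move=> [b]; rewrite mul1r => ub; apply: nu; exists b.
  apply: contrapT => /not_orP[na nb]; apply: na.
  (* Since [b] is outside [colon u], the colon ideal of [b * u] is a member of [F] containing
     [colon u]; maximality makes them equal. *)
  rewrite -(maxu (colon (b * u))).
  - by exists c; rewrite mulrA.
  - by exists (b * u).
  - by move=> d [e du]; exists (b * e); rewrite mulrCA du; ring.
exists u, (colon u); split=> //.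
case: (Pprime) => -[P0 _ Pmul] nP1 Pdisj.
pose S := [set z | exists n s, ~ colon u s /\ z = x ^+ n * s].
have [|||Q Qprime QS] := @prime_avoiding_multiplicative S noethA.
- by exists 0%N, 1; rewrite mulr1.
- move=> _ _ [m [s [ns ->]]] [n [t [nt ->]]]; exists (m + n)%N, (s * t).
  by split; [case/Pdisj | rewrite exprD; ring].
- move=> [n [s [ns e0]]]; apply: ns; suff -> : s = 0 by [].
  have xnreg := @lregX _ _ n xreg.
  by apply: xnreg; rewrite mulr0 -e0.
exists Q => //; split.
  move=> q Qq; apply: contrapT => nq; apply: (QS q) => //.
  by exists 0%N, q; rewrite mul1r.
(* [x] lies in [P] but, as [x ^+ 1 * 1], also in [S], which [Q] avoids. *)
move=> PQ; apply: (QS x); first by exists 1%N, 1; rewrite mulr1.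
by apply: PQ; exists u.
Qed.

End Noetherian.

(** * Local rings and the socle modulo a regular element *)

Section LocalRing.
Variable A : comUnitRingType.
Hypothesis localA : local_ring A.

Lemma maxid0 : @maxid A 0. Proof. by case: localA. Qed.

Lemma maxidD (a b : A) : maxid a -> maxid b -> maxid (a + b).
Proof. by case: localA => _ + _; apply. Qed.

Lemma maxidMl (a b : A) : maxid b -> maxid (a * b).
Proof. by case: localA => _ _; apply. Qed.

Lemma maxidMr (a b : A) : maxid a -> maxid (a * b).
Proof. by rewrite mulrC; exact: maxidMl. Qed.

Lemma maxidN (a : A) : maxid a -> maxid (- a).
Proof. by rewrite -mulN1r; exact: maxidMl. Qed.

Lemma maxidB (a b : A) : maxid a -> maxid b -> maxid (a - b).
Proof. by move=> ma mb; apply: maxidD => //; exact: maxidN. Qed.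

Lemma maxid1 : ~ @maxid A 1.
Proof. by rewrite /maxid /= unitr1. Qed.

Lemma maxid_prime : is_prime_ideal (@maxid A).
Proof.
split=> // [|x y]; first exact: maxid1.
rewrite /maxid /= unitrM => /nandP[]; tauto.
Qed.

Lemma prime_sub_maxid (P : set A) : is_prime_ideal P -> P `<=` @maxid A.
Proof.
case=> -[_ _ Pmul] nP1 _ x Px; apply/negP => ux; apply: nP1.
by rewrite -(mulVr ux); exact: Pmul.
Qed.

(** The prime [P] of [prime_colon_ideal] contains a smaller prime [Q]; if [P] were not the maximal
    ideal, [Q], [P] and [maxid] would form a chain of length 2. *)
Lemma socle_mod_regular (x : A) : noetherian A -> ~ prime_chain A 2 ->
  maxid x -> GRing.lreg x ->
  exists2 u, ~ (exists b, u = x * b) &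
    forall a, maxid a -> exists b, a * u = x * b.
Proof.
move=> noethA dimA mx xreg.
have x_nunit : ~ exists b, 1 = x * b.
  by move=> [b e1]; apply: maxid1; rewrite e1; exact: maxidMr.
have [u [P [nu Pdef Pprime [Q Qprime QP]]]] :=
  prime_colon_ideal noethA xreg x_nunit.
exists u => // a ma; suff: P a by rewrite Pdef.
apply: contrapT => nPa; apply: dimA.
exists (fun i : 'I_3 => nth [set: A] [:: Q; P; @maxid A] i); split.
  by case=> [[|[|[|]]]] //= _; exact: maxid_prime.
have Pm : P `<` @maxid A.
  by split; [exact: prime_sub_maxid | move=> /(_ _ ma)].
case=> [[|[|[|]]]] //= ? [[|[|[|]]]] //= _ _.
case: QP Pm => QP nPQ [Pm nmP]; split; first exact: subset_trans QP Pm.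
by move=> mQ; apply: nmP; exact: subset_trans mQ QP.
Qed.

End LocalRing.

(** The dimensions inside [cohen_macaulay] and [dualising_module] are existentially quantified;
    uniqueness identifies them with 1. *)
Lemma krull_dim_uniq (A : comNzRingType) d e :
  krull_dim A d -> krull_dim A e -> d = e.
Proof.
have chainW m n : (m <= n)%N -> prime_chain A n -> prime_chain A m.
  move=> mn [P [Pprime Plt]].
  exists (fun i => P (widen_ord (mn : m.+1 <= n.+1)%N i)); split=> // i j ij.
  exact: Plt.
move=> [Cd nCd] [Ce nCe].
case: (ltngtP d e) => // [de|ed]; first by case: nCd; exact: chainW de Ce.
by case: nCe; exact: chainW ed Cd.
Qed.

Lemma regular_element_of_depth1 (A : comUnitRingType) :
  depth A^o 1 -> exists2 x : A, maxid x & GRing.lreg x.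
Proof.
case=> -[xs [size_xs mxs [reg _]]] _.
case: xs size_xs mxs reg => [|x [|]] //= _ mxs reg.
exists x; first by apply: mxs; rewrite mem_head.
apply/mulrI0_lreg => y xy0.
have: seq_submod (take 0 [:: x]) (x *: (y : A^o)).
  by exists (fun=> 0); rewrite big_ord0; exact: xy0.
by move=> /(reg 0%N isT)[m]; rewrite big_ord0.
Qed.

(** * Type of a Gorenstein local ring of dimension one *)

Section MaximalIdealModule.
Variable A : comUnitRingType.
Hypothesis localA : local_ring A.

Let nonunit : pred A^o := fun x => x \isn't a GRing.unit.

Fact nonunit_submod_closed : submod_closed nonunit.
Proof.
split; first exact: maxid0 localA.
by move=> a x y mx my; apply: (maxidD localA) => //; exact: (maxidMl localA).
Qed.

HB.instance Definition _ :=
  GRing.isSubmodClosed.Build A A^o nonunit nonunit_submod_closed.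

(** [injective_module] ranges over bundled modules, so the maximal ideal is made an [lmodType] with
    an inclusion into [A^o]. *)
Record maxid_sub := MaxidSub { maxid_val :> A^o; _ : nonunit maxid_val }.
HB.instance Definition _ := [isSub for maxid_val].
HB.instance Definition _ := [Choice of maxid_sub by <:].
HB.instance Definition _ := [SubChoice_isSubLmodule of maxid_sub by <:].

(** A map from the maximal ideal to [E] extends to [A^o], and the extension is determined by the
    image [e] of 1. Linearity of the total function [g] is asked only on the maximal ideal. *)
Lemma injective_extends_maxid (E : lmodType A) (g : A -> E) :
  injective_module E ->
  (forall c a b, maxid a -> maxid b -> g (c * a + b) = c *: g a + g b) ->
  exists e, forall a, maxid a -> a *: e = g a.
Proof.
move=> injE glin.
pose g' (a : maxid_sub) : E := g (val a).
have g'_lin : linear g'.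
  move=> c a b; rewrite /g' linearP.
  by apply: glin; [exact: (valP a) | exact: (valP b)].
pose gL := GRing.isLinear.Build A maxid_sub E *:%R g' g'_lin.
pose gl : {linear maxid_sub -> E} := HB.pack g' gL.
pose vl : {linear maxid_sub -> A^o} := val.
have [h hE] := injE maxid_sub A^o vl gl val_inj.
exists (h (1 : A^o)) => a ma.
have <- : h (a : A^o) = g a by exact: (hE (MaxidSub ma)).
by rewrite -linearZ; congr (h _); exact: mulr1.
Qed.

End MaximalIdealModule.

(* An element y of (x : m) defines an extension of k by A: the map a |-> ay/x
   from m to A extends to A -> I^0, 1 |-> e, and d e is the class. *)
Lemma ext1_class (A : comUnitRingType) (W : lmodType A)
    (f : {linear A^o -> W}) (I : inj_resolution W) (x y : A) :
  local_ring A -> maxid x -> GRing.lreg x ->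
  (forall a, maxid a -> exists b, a * y = x * b) ->
  exists e : ires_mod I 0%N, ext_cocycle (ires_diff I 0%N e : ires_mod I 1%N) /\
    forall a, maxid a -> forall b, a * y = x * b ->
      a *: e = ires_aug I (f b).
Proof.
move=> localA mx xreg hy.
(* [q a] is the quotient a y / x, with the dummy value 0 off the maximal ideal. *)
have /choice[q qE] : forall a, exists b, maxid a -> a * y = x * b.
  move=> a; have [ma|nma] := pselect (maxid a); last by exists 0.
  by have [b hb] := hy a ma; exists b.
have q_uniq a b : maxid a -> a * y = x * b -> q a = b.
  by move=> ma hb; apply: xreg; rewrite -hb -qE.
have [|e eE] := @injective_extends_maxid A localA _
    (fun a => ires_aug I (f (q a))) (@ires_injective _ _ I 0%N).
  move=> c a b ma mb; rewrite -!linearP; congr (ires_aug I (f _)).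
  apply: q_uniq; first by apply: maxidD => //; exact: maxidMl.
  by rewrite mulrDl -mulrA !qE //=; rewrite mulrDr mulrCA.
exists e; split; last by move=> a ma b hb; rewrite eE // (q_uniq a b).
split=> [a ma|]; last by apply/ires_exact; exists e.
by rewrite -linearZ /= eE //; apply/ires_exact0; exists (f (q a)).
Qed.

(** Hom(k, A/x) injects into Ext^1(k, A): [y] and [z] give two classes in a one-dimensional space,
    and a relation between the classes descends to one modulo [x]. *)
Lemma gorenstein_type_le1 (A : comUnitRingType) (x y z : A) :
  local_ring A -> krull_dim A 1 -> gorenstein A -> maxid x -> GRing.lreg x ->
  (forall a, maxid a -> exists b, a * y = x * b) ->
  (forall a, maxid a -> exists b, a * z = x * b) ->
  exists a b c, a * y + b * z = x * c /\ ~ (maxid a /\ maxid b).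
Proof.
move=> localA dimA [W [[_ [d [dimW _ extW _]]] [f bijf]]] mx xreg hy hz.
move: extW; rewrite -(krull_dim_uniq dimA dimW) {d dimW}.
move=> [I [w [w_cocycle w_gen _]]].
have [e [e_cocycle eE]] := ext1_class f I localA mx xreg hy.
have [e' [e'_cocycle e'E]] := ext1_class f I localA mx xreg hz.
have [c ce] := w_gen _ e_cocycle; have [c' ce'] := w_gen _ e'_cocycle.
(* Modulo boundaries of socle elements [s] and [s'], the two classes are [t] and [t'] times the
   generator [w0]. *)
move: ce ce'; rewrite !big_ord1; set t := c _; set t' := c' _.
set w0 := w _ => -[s soc_s se] [s' soc_s' s'e].
have relation a b : maxid (a * t + b * t') -> exists r, a * y + b * z = x * r.
  (* The differential of [v] is (a t + b t') w0, which vanishes since the maximal ideal kills [w0];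
     so [v] comes from [W]. *)
  move=> mab; pose v := a *: (e - s) + b *: (e' - s').
  have [u vE] : exists u, v = ires_aug I u.
    apply/ires_exact0; rewrite linearD !linearZ !linearB /= se s'e !subKr.
    by rewrite !scalerA -scalerDl; have [soc _] := w_cocycle ord0; exact: soc.
  have [g _ gK] := bijf; exists (g u).
  have [r yr] := hy _ mx; have [r' zr'] := hz _ mx.
  apply: xreg; rewrite mulrDr !(mulrCA x) yr zr' !(mulrCA _ x) -mulrDr.
  congr (_ * _).
  (* Multiplying by [x] kills [s] and [s'] and turns [e] and [e'] into images of ring elements, so
     the equation descends to [A]. *)
  have: x *: v = ires_aug I (f (a * r + b * r' : A^o)).
    rewrite scalerDr !scalerA !(mulrC x) -!scalerA [x *: (e - s)]scalerBr.
    rewrite [x *: (e' - s')]scalerBr soc_s // soc_s' // !subr0.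
    by rewrite (eE x mx _ yr) (e'E x mx _ zr') !linearD !linearZ.
  rewrite vE -linearZ => /ires_aug_inj.
  by rewrite -{1}(gK u) -linearZ => /(bij_inj bijf) <-.
(* The coefficients are (1, 0) if [t] is in the maximal ideal, and otherwise (t', -t), which cancels
   exactly and contains a unit. *)
have [mt|nmt] := pselect (maxid t).
  have [|r rE] := relation 1 0; first by rewrite mul1r mul0r addr0.
  by exists 1, 0, r; split=> // -[/maxid1].
have [|r rE] := relation t' (- t).
  by rewrite mulNr (mulrC t) subrr; exact: maxid0.
exists t', (- t), r; split=> // -[_ /(maxidN localA)].
by rewrite opprK.
Qed.

(** * Gluings *)

Definition uniformizer (A : comUnitRingType) (t : A) : Prop :=
  GRing.lreg t /\ forall a, maxid a <-> exists b, a = t * b.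

Lemma uniformizer_maxid (A : comUnitRingType) (t : A) : uniformizer t -> maxid t.
Proof. by case=> _ tP; apply/tP; exists 1; rewrite mulr1. Qed.

Section Gluing.
Variables (K : fieldType) (A A1 A2 : comUnitAlgType K).
Variables (p1 : {lrmorphism A -> A1}) (p2 : {lrmorphism A -> A2}).
Hypothesis glue : is_gluing p1 p2.

Lemma gluing_sym : is_gluing p2 p1.
Proof.
case: glue => inj surj; split=> [a b [e2 e1]|a2 a1].
  by apply: inj; rewrite e1 e2.
split=> [[c [r2 r1]]|[a [e2 e1]]].
  have [|a [e1 e2]] := (surj a1 a2).1; first by exists c.
  by exists a.
have [|c [r1 r2]] := (surj a1 a2).2; first by exists a.
by exists c.
Qed.

Lemma gluing_inj a b : p1 a = p1 b -> p2 a = p2 b -> a = b.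
Proof. by case: glue => inj _ e1 e2; apply: inj; rewrite e1 e2. Qed.

Lemma gluing_lift a1 a2 c : has_residue a1 c -> has_residue a2 c ->
  exists a, p1 a = a1 /\ p2 a = a2.
Proof. by case: glue => _ surj r1 r2; apply/surj; exists c. Qed.

Lemma gluing_lift_maxid a1 a2 : maxid a1 -> maxid a2 ->
  exists a, p1 a = a1 /\ p2 a = a2.
Proof.
move=> m1 m2; apply: (@gluing_lift _ _ 0);
  by rewrite /has_residue scale0r subr0.
Qed.

Hypothesis germA1 : curve_germ A1.

Lemma gluing_surj1 a1 : exists a, p1 a = a1.
Proof.
have [_ _ /(_ a1)[c r1] _ _] := germA1.
have [|a [e1 _]] := @gluing_lift a1 c%:A c r1; last by exists a.
by rewrite /has_residue subrr /maxid /= unitr0.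
Qed.

Hypothesis localA : local_ring A.

(** [p1] is onto, so if p1 a is a unit, some [b] makes a b - 1 map to 0, and a b - 1 is a nonunit.
    With [a] in the maximal ideal this would put 1 there too. *)
Lemma gluing_maxid1 a : maxid a <-> maxid (p1 a).
Proof.
have down b : maxid (p1 b) -> maxid b.
  by apply: contra => ub; exact: rmorph_unit.
split=> [ma|]; last exact: down.
apply/negP => ua; have [b pb] := gluing_surj1 (p1 a)^-1.
apply: (@maxid1 A); rewrite -(subKr (a * b) 1).
apply: maxidB => //; first exact: maxidMr.
apply: down; rewrite rmorphB rmorphM rmorph1 /= pb divrr // subrr.
by rewrite /maxid /= unitr0.
Qed.

End Gluing.

(** * Principal maximal ideals of the two branches *)

Lemma germ_regular (K : fieldType) (A : comUnitAlgType K) :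
  curve_germ A -> exists2 x : A, maxid x & GRing.lreg x.
Proof.
move=> [_ _ _ dim1 [d [dimd]]]; rewrite -(krull_dim_uniq dim1 dimd).
exact: regular_element_of_depth1.
Qed.

(* With x = (x1, x2), both (x1, 0) and (u, 0) for u in m1 with m1 u <= x1 m1
   lie in the socle of A / x; as the former is nonzero there and the socle is
   one-dimensional, u is a multiple of x1. *)
Lemma gluing_socle_trivial (K : fieldType) (A A1 A2 : comUnitAlgType K)
    (p1 : {lrmorphism A -> A1}) (p2 : {lrmorphism A -> A2}) (x1 u : A1) :
  curve_germ A -> curve_germ A1 -> curve_germ A2 -> is_gluing p1 p2 ->
  gorenstein A -> maxid x1 -> GRing.lreg x1 -> maxid u ->
  (forall a, maxid a -> exists2 b, maxid b & a * u = x1 * b) ->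
  exists b, u = x1 * b.
Proof.
move=> germA germA1 germA2 glue gorA mx1 x1reg mu hu.
have [[_ localA _ dimA _] [_ localA1 _ _ _] [_ localA2 _ _ _]] :=
  And3 germA germA1 germA2.
have [x2 mx2 x2reg] := germ_regular germA2.
have [x [px1 px2]] := gluing_lift_maxid glue mx1 mx2.
have [y [py1 py2]] := gluing_lift_maxid glue mx1 (maxid0 localA2).
have [z [pz1 pz2]] := gluing_lift_maxid glue mu (maxid0 localA2).
have m1P := gluing_maxid1 glue germA1 localA.
have m2P := gluing_maxid1 (gluing_sym glue) germA2 localA.
have mx : maxid x by apply/m1P; rewrite px1.
have xreg : GRing.lreg x.
  apply/mulrI0_lreg => a xa0; apply: (gluing_inj glue); rewrite rmorph0.
    by apply: x1reg; rewrite -px1 -rmorphM xa0 rmorph0 mulr0.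
  by apply: x2reg; rewrite -px2 -rmorphM xa0 rmorph0 mulr0.
(* The cofactor [b1] has to be a nonunit: only then is (b1, 0) an element of the gluing. *)
have socle_of v v1 : p1 v = v1 -> p2 v = 0 ->
    (forall a, maxid a -> exists2 b, maxid b & a * v1 = x1 * b) ->
    forall a, maxid a -> exists b, a * v = x * b.
  move=> pv1 pv2 hv a ma; have [b1 mb1 eb1] := hv _ ((m1P a).1 ma).
  have [b [pb1 pb2]] := gluing_lift_maxid glue mb1 (maxid0 localA2).
  exists b; apply: (gluing_inj glue); rewrite !rmorphM /=.
    by rewrite pv1 eb1 px1 pb1.
  by rewrite pv2 pb2 !mulr0.
have hy := socle_of _ _ py1 py2 (fun a ma => ex_intro2 _ _ a ma (mulrC a x1)).
have hz := socle_of _ _ pz1 pz2 hu.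
have [a [b [c [abc nab]]]] :=
  gorenstein_type_le1 localA dimA gorA mx xreg hy hz.
(* On the second branch the relation reads x2 p2(c) = 0. *)
have mc : maxid c.
  apply/m2P; suff -> : p2 c = 0 by exact: maxid0.
  apply: x2reg; rewrite -px2 -rmorphM -abc rmorphD !rmorphM /= py2 pz2.
  by rewrite !mulr0 addr0.
have e1 : p1 a * x1 + p1 b * u = x1 * p1 c.
  by have := congr1 p1 abc; rewrite rmorphD !rmorphM /= py1 pz1 px1.
(* A nonunit coefficient of [u] would force p1 a = p1 c - d into the maximal ideal, against [nab]; a
   unit one can be divided out. *)
have [mb|nmb] := pselect (maxid (p1 b)).
  case: nab; split; last exact/m1P.
  have [d md ed] := hu _ mb; apply/m1P.
  suff -> : p1 a = p1 c - d by apply: maxidB => //; exact/m1P.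
  apply: x1reg; rewrite mulrBr -ed -e1; ring.
move/negP: nmb; rewrite negbK => ub; exists ((p1 b)^-1 * (p1 c - p1 a)).
rewrite mulrCA mulrBr -e1 [x1 * _]mulrC addrAC subrr add0r mulrA mulVr //.
by rewrite mul1r.
Qed.

(** Take [x] regular and [u] outside (x) with m1 u in (x). If [u] is a unit, m1 = (x). Otherwise
    [gluing_socle_trivial] forbids m1 u <= x m1, so a u = x b for some [a] in m1 and a unit [b]. *)
Lemma gluing_uniformizer (K : fieldType) (A A1 A2 : comUnitAlgType K)
    (p1 : {lrmorphism A -> A1}) (p2 : {lrmorphism A -> A2}) :
  curve_germ A -> curve_germ A1 -> curve_germ A2 -> is_gluing p1 p2 ->
  gorenstein A -> exists t : A1, uniformizer t.
Proof.
move=> germA germA1 germA2 glue gorA.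
have [noethA1 localA1 _ [_ dimA1] _] := germA1.
have [x mx xreg] := germ_regular germA1.
have [u nu hu] := socle_mod_regular localA1 noethA1 dimA1 mx xreg.
have [mu|/negP] := pselect (maxid u); last first.
  rewrite negbK => uu; exists x; split=> // a; split=> [ma|[b ->]].
    have [b ab] := hu a ma; exists (b * u^-1).
    by rewrite mulrA -ab mulrK.
  exact: maxidMr.
have [hu'|] :=
    pselect (forall a, maxid a -> exists2 b, maxid b & a * u = x * b).
  case: nu.
  exact: (gluing_socle_trivial germA germA1 germA2 glue gorA mx xreg mu).
(* Here x = t u for some t in m1; as m1 u <= (x) = (t u), it follows that
   m1 = (t). *)
move=> /existsNP[a /not_implyP[ma na]]; have [b ab] := hu a ma.
have ub : b \is a GRing.unit.
  by apply: contrapT => nb; apply: na; exists b => //; exact/negP.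
pose t := a * b^-1; have xtu : x = t * u by rewrite /t mulrAC ab mulrK.
have treg : GRing.lreg t.
  by apply/mulrI0_lreg => y ty; apply: xreg; rewrite xtu mulr0 mulrAC ty mul0r.
have ureg : GRing.lreg u.
  by apply/mulrI0_lreg => y uy; apply: xreg; rewrite xtu mulr0 -mulrA uy mulr0.
exists t; split=> // c; split=> [mc|[d ->]].
  have [d cd] := hu c mc; exists d; apply: ureg.
  by rewrite mulrC cd xtu; ring.
by apply: maxidMr => //; exact: maxidMr.
Qed.

(** * Power series and the complete local ring of a node *)

Section FpsAlgebra.
Variable K : comNzRingType.
Implicit Types f g : fps K.

Lemma fcoefD f g n : fcoef (f + g) n = fcoef f n + fcoef g n.
Proof. by []. Qed.

Lemma fcoefM f g n :
  fcoef (f * g) n = \sum_(i < n.+1) fcoef f i * fcoef g (n - i)%N.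
Proof. by []. Qed.

Lemma fcoefM0 f g : fcoef (f * g) 0%N = fcoef f 0%N * fcoef g 0%N.
Proof. by rewrite fcoefM big_ord1. Qed.

Definition fps_scale (c : K) f : fps K := Fps (fun n => c * fcoef f n).

Fact fps_scaleA a b f : fps_scale a (fps_scale b f) = fps_scale (a * b) f.
Proof. by apply: fpsP => n /=; rewrite mulrA. Qed.

Fact fps_scale1 : left_id 1 fps_scale.
Proof. by move=> f; apply: fpsP => n /=; rewrite mul1r. Qed.

Fact fps_scaleDr : right_distributive fps_scale +%R.
Proof. by move=> c f g; apply: fpsP => n /=; rewrite mulrDr. Qed.

Fact fps_scaleDl f : {morph fps_scale^~ f : a b / a + b}.
Proof. by move=> a b; apply: fpsP => n /=; rewrite mulrDl. Qed.

HB.instance Definition _ := GRing.Zmodule_isLmodule.Build K (fps K)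
  fps_scaleA fps_scale1 fps_scaleDr fps_scaleDl.

Fact fps_scaleAl (c : K) f g : c *: (f * g) = c *: f * g.
Proof.
apply: fpsP => n; rewrite fcoefM /= mulr_sumr.
by apply: eq_bigr => i _; rewrite mulrA.
Qed.

HB.instance Definition _ :=
  GRing.Lmodule_isLalgebra.Build K (fps K) fps_scaleAl.
HB.instance Definition _ := GRing.Lalgebra_isComAlgebra.Build K (fps K).

Definition fps_shift n f : fps K := Fps (fun i => fcoef f (i + n)%N).

Lemma fcoefXM f n :
  fcoef (fpsX K * f) n = if n is n'.+1 then fcoef f n' else 0.
Proof.
rewrite fcoefM; case: n => [|n]; first by rewrite big_ord1 mul0r.
rewrite big_ord_recl mul0r add0r big_ord_recl /= mul1r subSS subn0.
by rewrite big1 ?addr0 // => i _; rewrite mul0r.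
Qed.

Lemma fcoefXnM f k n :
  fcoef (fpsX K ^+ k * f) n = if (n < k)%N then 0 else fcoef f (n - k)%N.
Proof.
elim: k n => [|k IHk] n; first by rewrite expr0 mul1r subn0.
by rewrite exprS -mulrA fcoefXM; case: n => [|n] //; rewrite IHk subSS.
Qed.

Lemma fps_shiftK f n : (forall i, (i < n)%N -> fcoef f i = 0) ->
  f = fpsX K ^+ n * fps_shift n f.
Proof.
move=> f0; apply: fpsP => i; rewrite fcoefXnM /=.
by case: ltnP => [/f0 //|/subnK ->].
Qed.

Lemma fcoef_ideal n :
  is_ideal [set f : fps K | forall i, (i < n)%N -> fcoef f i = 0].
Proof.
split=> [//|f g f0 g0 i lin|a f f0 i lin].
  by rewrite fcoefD f0 // g0 // addr0.
rewrite fcoefM big1 // => j _; rewrite f0 ?mulr0 //.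
exact: leq_ltn_trans (leq_subr _ _) lin.
Qed.

End FpsAlgebra.

(** * The node as pairs of power series with equal constant terms *)

Section NodeRing.
Variable K : comNzRingType.

Let same_constant : pred (fps K * fps K)%type :=
  fun fg => fcoef fg.1 0%N == fcoef fg.2 0%N.

Fact same_constant_subalg : subalg_closed same_constant.
Proof.
split=> [|c f g|f g]; rewrite /same_constant !unfold_in //=.
  by move=> /eqP -> /eqP ->.
by rewrite !big_ord1 => /eqP -> /eqP ->.
Qed.

HB.instance Definition _ := GRing.isSubalgClosed.Build K (fps K * fps K)%type
  same_constant same_constant_subalg.

Record node_ring :=
  NodeRing { branches :> fps K * fps K; _ : same_constant branches }.
HB.instance Definition _ := [isSub for branches].
HB.instance Definition _ := [Choice of node_ring by <:].
HB.instance Definition _ := [SubChoice_isSubComNzRing of node_ring by <:].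
HB.instance Definition _ := [SubNmodule_isSubLSemiModule of node_ring by <:].
HB.instance Definition _ :=
  [SubNzRing_SubLmodule_isSubLalgebra of node_ring by <:].
HB.instance Definition _ := GRing.Lalgebra_isComAlgebra.Build K node_ring.

Implicit Types b : node_ring.

Lemma node_ringP b b' : b.1 = b'.1 -> b.2 = b'.2 -> b = b'.
Proof.
move: b b' => [[f g] ?] [[f' g'] ?] /= e1 e2.
by apply: val_inj; rewrite /= e1 e2.
Qed.

Lemma node_ring_constant b : fcoef b.1 0%N = fcoef b.2 0%N.
Proof. by case: b => fg /= /eqP. Qed.

Lemma node_ring_pair (f g : fps K) : fcoef f 0%N = fcoef g 0%N ->
  exists b, b.1 = f /\ b.2 = g.
Proof. by move/eqP => e; exists (@NodeRing (f, g) e). Qed.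

(** The pair of s(x, 0) and s(0, y): x being the variable of the coefficient ring, the first is the
    coefficient of y^0 and the second collects the constant terms in x. *)
Definition node_pres (s : fps2 K) : node_ring :=
  @NodeRing (fcoef s 0%N, Fps (fun n => fcoef (fcoef s n) 0%N)) (eqxx _).

Fact node_pres_additive : zmod_morphism node_pres.
Proof. by move=> s t; apply: node_ringP. Qed.

Fact node_pres_multiplicative : monoid_morphism node_pres.
Proof.
split; first by apply: node_ringP => //; apply: fpsP => -[].
move=> s t; apply: node_ringP; first exact: fcoefM0.
apply: fpsP => n; rewrite fcoefM /=.
rewrite (big_morph (fun f : fps K => fcoef f 0%N)
          (id1 := 0) (op1 := +%R)) //.
by apply: eq_bigr => i _; rewrite fcoefM0.
Qed.

HB.instance Definition _ := GRing.isZmodMorphism.Build (fps2 K) node_ring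
  node_pres node_pres_additive.
HB.instance Definition _ := GRing.isMonoidMorphism.Build (fps2 K) node_ring
  node_pres node_pres_multiplicative.

End NodeRing.

Arguments node_pres {K}.

Lemma node_presP (K : fieldType) :
  is_node_presentation (@node_pres K : {rmorphism fps2 K -> node_ring K}).
Proof.
split=> [c|b|s].
- apply: node_ringP; apply: fpsP => n /=; rewrite ?mulr1; case: n => [|n] //=.
  + by rewrite mulr1.
  + by rewrite mulr0.
  + by rewrite mulr1.
  + by rewrite mulr0.
(* The preimage is b.1(x) + b.2(y) minus the common constant term. *)
- exists (Fps (fun n => if n is n'.+1 then fpsC (fcoef b.2 n) else b.1)).
  apply: node_ringP => //; apply: fpsP => -[|n] //=.
  exact: node_ring_constant.
split=> [s0|[t ->]].
  have s1 : fcoef s 0%N = 0 by exact: (congr1 (fun b : node_ring K => b.1) s0).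
  have s2 n : fcoef (fcoef s n) 0%N = 0.
    exact: (congr1 (fun b : node_ring K => fcoef b.2 n) s0).
  (* The witness is s / (x y): the index [n.+1] removes a factor y and the shift by 1 a factor x. *)
  exists (Fps (fun n => fps_shift 1 (fcoef s n.+1))).
  rewrite -mulrA mulrCA; apply: fpsP => n; rewrite fcoefXM.
  case: n => [//|n]; rewrite fcoefM big_ord_recl big1 ?addr0 => [|i _]; last first.
    by rewrite /= mul0r.
  rewrite subn0 /=; have := @fps_shiftK _ (fcoef s n.+1) 1; rewrite expr1; apply.
  by case.
(* x maps to (X, 0) and y to (0, X). *)
rewrite !rmorphM; suff -> : node_pres (fps2x K) * node_pres (fps2y K) = 0.
  by rewrite mul0r.
apply: node_ringP.
  by rewrite /= mulr0.
transitivity ((node_pres (fps2x K)).2 * (node_pres (fps2y K)).2) => //.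
suff -> : (node_pres (fps2x K)).2 = 0 by rewrite mul0r.
by apply: fpsP => -[|n].
Qed.

(** * Expansion along a uniformizer *)

Section Expansion.
Variables (K : fieldType) (A : comUnitAlgType K) (t : A).
Hypothesis residueA : forall a : A, exists c : K, has_residue a c.
Hypothesis unif : uniformizer t.

Lemma expansion_step_uniq (c d : K) (a b : A) :
  c%:A + t * a = d%:A + t * b -> c = d /\ a = b.
Proof.
case: unif => treg tP e; suff cd : c = d.
  by split=> //; apply: treg; move: e; rewrite cd => /addrI.
apply/eqP; rewrite -subr_eq0; apply/negPn/negP => ncd.
have /negP : maxid ((c - d)%:A : A).
  apply/tP; exists (b - a); rewrite scalerBl mulrBr.
  by apply/eqP; rewrite subr_eq addrAC -subr_eq opprK e addrC.
by rewrite scaler_unit ?unitfE ?unitr1.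
Qed.

Lemma expansion_step_ex (a : A) : exists cb : K * A, a = cb.1%:A + t * cb.2.
Proof.
have [c] := residueA a; case: unif => _ tP; move=> /tP[b ab]; exists (c, b).
by rewrite -ab addrC subrK.
Qed.

Let step a := projT1 (cid (expansion_step_ex a)).

Let stepE a : a = (step a).1%:A + t * (step a).2.
Proof. exact: (projT2 (cid (expansion_step_ex a))). Qed.

Let step_eq a c b : a = c%:A + t * b -> step a = (c, b).
Proof.
rewrite {1}(stepE a) => /expansion_step_uniq[e1 e2].
by rewrite [LHS]surjective_pairing e1 e2.
Qed.

(** Digits in base [t]: take the residue, subtract it, divide by [t], repeat. *)
Fixpoint expansion_coef (a : A) (n : nat) : K :=
  if n is n'.+1 then expansion_coef (step a).2 n' else (step a).1.

Definition expansion (a : A) : fps K := Fps (expansion_coef a).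

Lemma expansion_cons (c : K) (a : A) :
  expansion (c%:A + t * a) = c%:A + fpsX K * expansion a.
Proof.
apply: fpsP => n; rewrite fcoefD fcoefXM /=; case: n => [|n] /=;
  rewrite (@step_eq _ c a erefl) /=; first by rewrite mulr1 addr0.
by rewrite mulr0 add0r.
Qed.

Let expansion_linear_coef (k : K) n a b :
  expansion_coef (k *: a + b) n = k * expansion_coef a n + expansion_coef b n.
Proof.
elim: n a b => [|n IHn] a b /=;
  rewrite (@step_eq (k *: a + b) (k * (step a).1 + (step b).1)
             (k *: (step a).2 + (step b).2)) //=;
  rewrite {1}(stepE a) {1}(stepE b) scalerDr scalerDl scalerA mulrDr scalerAr;
  ring.
Qed.

Fact expansion_linear : linear expansion.
Proof. by move=> k a b; apply: fpsP => n; exact: expansion_linear_coef. Qed.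

HB.instance Definition _ := GRing.isLinear.Build K A (fps K) *:%R expansion
  expansion_linear.

Let stepM a b : step (a * b) =
  ((step a).1 * (step b).1, (step a).2 * b + (step a).1 *: (step b).2).
Proof.
apply: step_eq; rewrite {1}(stepE a) mulrDl mulr_algl {1}(stepE b).
by rewrite scalerDr scalerA mulrDr -scalerAr mulrA addrAC addrA.
Qed.

Let expansion_mul_coef n a b :
  expansion_coef (a * b) n =
  \sum_(i < n.+1) expansion_coef a i * expansion_coef b (n - i)%N.
Proof.
elim: n a b => [|n IHn] a b; first by rewrite big_ord1 /= stepM.
(* With a', b' the tails and a0 the residue of [a], the tail of a b is a' b + a0 b'. The second
   summand gives the first term of the Cauchy product, the induction hypothesis on a' b the
   others. *)
rewrite big_ord_recl /= stepM /= addrC expansion_linear_coef IHn.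
by congr (_ + _); apply: eq_bigr => i _; rewrite subSS.
Qed.

Fact expansion_monoid_morphism : monoid_morphism expansion.
Proof.
split=> [|a b]; last by apply: fpsP => n; exact: expansion_mul_coef.
rewrite -[1]addr0 -[0](mulr0 t) -[X in X + _]scale1r expansion_cons.
by rewrite linear0 mulr0 addr0 scale1r.
Qed.

HB.instance Definition _ := GRing.isMonoidMorphism.Build A (fps K) expansion
  expansion_monoid_morphism.

Lemma expansion_unif : expansion t = fpsX K.
Proof.
have := expansion_cons 0 1; rewrite !scale0r !add0r mulr1 => ->.
by rewrite rmorph1 mulr1.
Qed.

Lemma expansion_order (a : A) n :
  (forall i, (i < n)%N -> fcoef (expansion a) i = 0) <->
  exists b, a = t ^+ n * b.
Proof.
split=> [|[b ->] i lin]; last first.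
  have -> : expansion (t ^+ n * b) = fpsX K ^+ n * expansion b.
    by rewrite -expansion_unif -rmorphXn -rmorphM.
  by rewrite fcoefXnM lin.
elim: n a => [|n IHn] a a0; first by exists a; rewrite mul1r.
have [|b ab] := IHn (step a).2; first by move=> i lin; exact: (a0 i.+1).
have a00 : (step a).1 = 0 := a0 0%N isT.
by exists b; rewrite (stepE a) a00 scale0r add0r ab exprS mulrA.
Qed.

(** The witness is the truncation of [f] evaluated at [t] by Horner's scheme. *)
Lemma expansion_dense (f : fps K) n :
  exists a, forall i, (i < n)%N -> fcoef (expansion a) i = fcoef f i.
Proof.
elim: n f => [|n IHn] f; first by exists 0.
have [a aE] := IHn (fps_shift 1 f).
exists ((fcoef f 0%N)%:A + t * a) => i lin.
rewrite expansion_cons fcoefD fcoefXM.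
case: i lin => [|i] /= lin; first by rewrite mulr1 addr0.
by rewrite mulr0 add0r -addn1; exact: aE.
Qed.

Lemma expansion_residue (a : A) : has_residue a (fcoef (expansion a) 0%N).
Proof.
case: unif => _ tP; apply/tP; exists (step a).2.
by rewrite /= {1}(stepE a) addrC addKr.
Qed.

Lemma residue_expansion (a : A) c :
  has_residue a c -> fcoef (expansion a) 0%N = c.
Proof.
case: unif => _ tP /tP[b ab].
by rewrite /= (@step_eq a c b) // -ab addrC subrK.
Qed.

Record power_series_expansion (E : {lrmorphism A -> fps K}) : Prop := {
  pse_unif : E t = fpsX K;
  pse_order : forall a n,
    (forall i, (i < n)%N -> fcoef (E a) i = 0) <-> exists b, a = t ^+ n * b;
  pse_dense : forall f n,
    exists a, forall i, (i < n)%N -> fcoef (E a) i = fcoef f i;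
  pse_residue : forall a, has_residue a (fcoef (E a) 0%N);
  pse_residue_uniq : forall a c, has_residue a c -> fcoef (E a) 0%N = c
}.

Lemma power_series_expansion_ex :
  exists E : {lrmorphism A -> fps K}, power_series_expansion E.
Proof.
exists expansion; split.
- exact: expansion_unif.
- exact: expansion_order.
- exact: expansion_dense.
- exact: expansion_residue.
- exact: residue_expansion.
Qed.

End Expansion.

(** * The completion of a gluing of two smooth branches *)

Section NodeCompletion.
Variables (K : fieldType) (A A1 A2 : comUnitAlgType K).
Variables (p1 : {lrmorphism A -> A1}) (p2 : {lrmorphism A -> A2}).
Hypothesis glue : is_gluing p1 p2.
Hypothesis localA : local_ring A.
Hypotheses (germA1 : curve_germ A1) (germA2 : curve_germ A2).
Variables (t1 : A1) (t2 : A2).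
Hypotheses (unif1 : uniformizer t1) (unif2 : uniformizer t2).
Variables (E1 : {lrmorphism A1 -> fps K}) (E2 : {lrmorphism A2 -> fps K}).
Hypotheses (E1P : power_series_expansion t1 E1).
Hypotheses (E2P : power_series_expansion t2 E2).

Let m1P := gluing_maxid1 glue germA1 localA.
Let m2P := gluing_maxid1 (gluing_sym glue) germA2 localA.

Lemma branch_parameters : exists T1 T2,
  [/\ p1 T1 = t1, p2 T1 = 0, p1 T2 = 0 & p2 T2 = t2].
Proof.
have [[_ local1 _ _ _] [_ local2 _ _ _]] := conj germA1 germA2.
have [T1 [e11 e12]] :=
  gluing_lift_maxid glue (uniformizer_maxid unif1) (maxid0 local2).
have [T2 [e21 e22]] :=
  gluing_lift_maxid glue (maxid0 local1) (uniformizer_maxid unif2).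
by exists T1, T2.
Qed.

(** For n > 0 a pair (t1^n b1, t2^n b2) is a combination of the n-th powers of T1 = (t1, 0) and T2 =
    (0, t2). *)
Lemma maxid_exp_gluing n (a : A) : ideal_exp (@maxid A) n a <->
  (exists b, p1 a = t1 ^+ n * b) /\ (exists b, p2 a = t2 ^+ n * b).
Proof.
split=> [|[[b1 e1] [b2 e2]]].
  pose J := [set a | (exists b, p1 a = t1 ^+ n * b) /\
                     (exists b, p2 a = t2 ^+ n * b)].
  move=> /(_ J); apply.
    split=> [|x y [[b1 e1] [b2 e2]] [[c1 f1] [c2 f2]]|c x [[b1 e1] [b2 e2]]].
    - by split; exists 0; rewrite rmorph0 mulr0.
    - by split; [exists (b1 + c1) | exists (b2 + c2)];
         rewrite rmorphD mulrDr /= ?e1 ?f1 ?e2 ?f2.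
    - by split; [exists (p1 c * b1) | exists (p2 c * b2)];
         rewrite rmorphM /= ?e1 ?e2 mulrCA.
  have prodP (B : comUnitAlgType K) (t : B) (q : {lrmorphism A -> B})
      (f : 'I_n -> A) : uniformizer t -> (forall a, maxid a <-> maxid (q a)) ->
      (forall i, maxid (f i)) -> exists b, q (\prod_(i < n) f i) = t ^+ n * b.
    move=> [_ tP] qP mf; have /choice[g gE] i : exists b, q (f i) = t * b.
      exact/tP/qP.
    exists (\prod_i g i); rewrite rmorph_prod /= (eq_bigr _ (fun i _ => gE i)).
    by rewrite big_split /= prodr_const card_ord.
  by move=> _ [f mf ->]; split; exact: prodP.
(* Exponent 0 is separate: the mixed terms below vanish because 0^(n+1) = 0, whereas 0^0 = 1. *)
case: n e1 e2 => [|n] e1 e2 I [I0 addI mulI] subI.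
  rewrite -[a]mulr1; apply: mulI; apply: subI.
  by exists (fun=> 0); [case | rewrite big_ord0].
have [T1 [T2 [e11 e12 e21 e22]]] := branch_parameters.
have [B1 f1] := gluing_surj1 glue germA1 b1.
have [B2 f2] := gluing_surj1 (gluing_sym glue) germA2 b2.
have powI T : maxid T -> I (T ^+ n.+1).
  move=> mT; apply: subI; exists (fun=> T) => //.
  by rewrite prodr_const card_ord.
have -> : a = B1 * T1 ^+ n.+1 + B2 * T2 ^+ n.+1.
  apply: (gluing_inj glue); rewrite rmorphD !rmorphM !rmorphXn /=.
    by rewrite e11 e21 f1 e1 [0 ^+ _]exprS mul0r mulr0 addr0 mulrC.
  by rewrite e12 e22 f2 e2 [0 ^+ _]exprS mul0r mulr0 add0r mulrC.
apply: addI; apply: mulI; apply: powI.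
  by apply/m1P; rewrite e11; exact: uniformizer_maxid.
by apply/m2P; rewrite e22; exact: uniformizer_maxid.
Qed.

Fact gluing_expansion_subproof a :
  fcoef (E1 (p1 a)) 0%N == fcoef (E2 (p2 a)) 0%N.
Proof.
case: glue => _ /(_ (p1 a) (p2 a))[_ []]; first by exists a.
by move=> c [/(pse_residue_uniq E1P) -> /(pse_residue_uniq E2P) ->].
Qed.

Definition gluing_expansion (a : A) : node_ring K :=
  @NodeRing K (E1 (p1 a), E2 (p2 a)) (gluing_expansion_subproof a).

Fact gluing_expansion_linear : linear gluing_expansion.
Proof. by move=> k a b; apply: node_ringP; rewrite /= !linearP. Qed.

HB.instance Definition _ := GRing.isLinear.Build K A (node_ring K) *:%R
  gluing_expansion gluing_expansion_linear.

Fact gluing_expansion_monoid_morphism : monoid_morphism gluing_expansion.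
Proof.
by split=> [|a b]; apply: node_ringP; rewrite /= ?rmorph1 ?rmorphM.
Qed.

HB.instance Definition _ := GRing.isMonoidMorphism.Build A (node_ring K)
  gluing_expansion gluing_expansion_monoid_morphism.

Let iota : {lrmorphism A -> node_ring K} := gluing_expansion.

Definition vanishing_order n : set (node_ring K) :=
  [set b | forall i, (i < n)%N -> fcoef b.1 i = 0 /\ fcoef b.2 i = 0].

Lemma vanishing_order_iota n a :
  vanishing_order n (iota a) <-> ideal_exp (@maxid A) n a.
Proof.
split=> [van|/maxid_exp_gluing[/(pse_order E1P) v1 /(pse_order E2P) v2] i lin].
  apply/maxid_exp_gluing; split.
    by apply/(pse_order E1P) => i /van[].
  by apply/(pse_order E2P) => i /van[].
by split; [exact: v1 | exact: v2].
Qed.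

(** The analogue of [maxid_exp_gluing] in the completion; it turns the clauses of [is_completion]
    into statements about coefficients. *)
Lemma ext_maxid_exp_gluing n : ext_maxid_exp iota n = vanishing_order n.
Proof.
apply/seteqP; split=> [b|b van].
  move=> /(_ (vanishing_order n)); apply.
    have [_ addV mulV] := fcoef_ideal K n.
    split=> [//|x y vx vy i lin|c x vx i lin]; split.
    - by apply: addV lin => j /=; [case/vx | case/vy].
    - by apply: addV lin => j /=; [case/vx | case/vy].
    - by apply: mulV lin => j /vx[].
    - by apply: mulV lin => j /vx[].
  by move=> _ [a ma <-]; exact/vanishing_order_iota.
move=> I [I0 addI mulI] subI.
case: n van subI => [|n] van subI.
  rewrite -[b]mulr1; apply: mulI; apply: subI; exists 1; last exact: rmorph1.
  exact/vanishing_order_iota.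
have [T1 [T2 [e11 e12 e21 e22]]] := branch_parameters.
pose f := fps_shift n.+1 b.1; pose g := fps_shift n.+1 b.2.
(* An element of [node_ring] needs a second component with the same constant term; a constant series
   serves, and its product with 0^(n+1) vanishes. *)
have [B1 [f1 _]] := @node_ring_pair K f (fpsC (fcoef f 0%N)) erefl.
have [B2 [_ g2]] := @node_ring_pair K (fpsC (fcoef g 0%N)) g erefl.
have powI T : maxid T -> I (iota T ^+ n.+1).
  move=> mT; rewrite -rmorphXn; apply: subI; exists (T ^+ n.+1) => //.
  move=> J _; apply; exists (fun=> T) => //.
  by rewrite prodr_const card_ord.
have -> : b = B1 * iota T1 ^+ n.+1 + B2 * iota T2 ^+ n.+1.
  rewrite -!rmorphXn; apply: node_ringP.
    transitivity (B1.1 * E1 (p1 (T1 ^+ n.+1)) + B2.1 * E1 (p1 (T2 ^+ n.+1))) => //.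
    rewrite !rmorphXn /= e11 e21 rmorph0 (pse_unif E1P) [0 ^+ _]exprS mul0r mulr0.
    rewrite addr0 f1 mulrC; apply: fps_shiftK => i /van[]//.
  transitivity (B1.2 * E2 (p2 (T1 ^+ n.+1)) + B2.2 * E2 (p2 (T2 ^+ n.+1))) => //.
  rewrite !rmorphXn /= e12 e22 rmorph0 (pse_unif E2P) [0 ^+ _]exprS mul0r mulr0.
  by rewrite add0r g2 mulrC; apply: fps_shiftK => i /van[].
apply: addI; apply: mulI; apply: powI.
  by apply/m1P; rewrite e11; exact: uniformizer_maxid.
by apply/m2P; rewrite e22; exact: uniformizer_maxid.
Qed.

Lemma gluing_expansion_completion : is_completion iota.
Proof.
split=> [n a|n b|b|u].
- by rewrite ext_maxid_exp_gluing => /vanishing_order_iota.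
(* Order [n.+1] rather than [n] makes the constant terms agree even when n = 0, so that [a1] and
   [a2] have a common residue and glue. *)
- have [a1 e1] := pse_dense E1P b.1 n.+1.
  have [a2 e2] := pse_dense E2P b.2 n.+1.
  have [||a [pa1 pa2]] := @gluing_lift _ _ _ _ _ _ glue a1 a2 (fcoef b.1 0%N).
  + by rewrite -e1 //; exact: (pse_residue E1P).
  + by rewrite node_ring_constant -e2 //; exact: (pse_residue E2P).
  exists a; rewrite ext_maxid_exp_gluing => i lin.
  have lin' : (i < n.+1)%N := ltnW lin; split.
    by rewrite -[LHS]/(fcoef b.1 i - fcoef (E1 (p1 a)) i) pa1 e1 ?subrr.
  by rewrite -[LHS]/(fcoef b.2 i - fcoef (E2 (p2 a)) i) pa2 e2 ?subrr.
- move=> van; apply: node_ringP; apply: fpsP => n;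
    by have := van n.+1; rewrite ext_maxid_exp_gluing => /(_ n (leqnn _))[].
(* Coefficient [i] of [u n] is stationary from n = i + 1 on, so the limit takes it from [u i.+1]. *)
move=> uC; have step i n : (i < n)%N ->
    fcoef (u n).1 i = fcoef (u i.+1).1 i /\ fcoef (u n).2 i = fcoef (u i.+1).2 i.
  elim: n => [//|n IHn]; rewrite ltnS leq_eqVlt => /orP[/eqP -> //|lin].
  have [<- <-] := IHn lin.
  have := uC n; rewrite ext_maxid_exp_gluing => /(_ i lin)[v1 v2].
  by split; apply/eqP; rewrite -subr_eq0; apply/eqP.
have [|b [b1 b2]] := @node_ring_pair K (Fps (fun i => fcoef (u i.+1).1 i))
                       (Fps (fun i => fcoef (u i.+1).2 i)).
  exact: node_ring_constant.
exists b => n; rewrite ext_maxid_exp_gluing => i lin.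
have [s1 s2] := step i n lin.
split.
  by rewrite -[LHS]/(fcoef b.1 i - fcoef (u n).1 i) b1 s1 subrr.
by rewrite -[LHS]/(fcoef b.2 i - fcoef (u n).2 i) b2 s2 subrr.
Qed.

Lemma gluing_node : node A.
Proof.
exists (node_ring K), iota, node_pres; split.
  exact: gluing_expansion_completion.
exact: node_presP.
Qed.

End NodeCompletion.

(** * From Gorenstein gluings to nodes *)

Lemma gorenstein_gluing_node (K : fieldType) (A : comUnitAlgType K) :
  curve_germ A -> decomposable A -> gorenstein A -> node A.
Proof.
move=> germA [A1 [A2 [p1 [p2 [germA1 germA2 glue]]]]] gorA.
have [t1 unif1] := gluing_uniformizer germA germA1 germA2 glue gorA.
have [t2 unif2] :=
  gluing_uniformizer germA germA2 germA1 (gluing_sym glue) gorA.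
have [_ localA _ _ _] := germA.
have [_ local1 res1 _ _] := germA1; have [_ local2 res2 _ _] := germA2.
have [E1 E1P] := power_series_expansion_ex res1 unif1.
have [E2 E2P] := power_series_expansion_ex res2 unif2.
exact: (gluing_node glue localA germA1 germA2 unif1 unif2 E1P E2P).
Qed.

Local Open Scope complex_scope.

Theorem lemma2p13 (R : realType) (A : comUnitAlgType R[i])
  (hcurve : curve_germ A) (hdec : decomposable A) (hgor : gorenstein A) :
  node A.
Proof. exact: gorenstein_gluing_node. Qed.
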